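(* Let $q$ be a prime power with $q\equiv 1 \pmod 4$ and let $P_q$ be the Paley graph with vertex set $V_q$ and edge set $E_q$. Let $x^*\in\mathbb{R}^q$ and $X^*\in\mathbb{R}^{q\times q}$ be given by $$x^*_i=\frac{1}{\sqrt q}\ \ \forall i\in V_q,\qquad X^*_{ii}=x^*_i\ \ \forall i\in V_q,\qquad X^*_{ij}=0\ \ \forall \{i,j\}\in E_q,$$ $$X^*_{ij}=\frac{2}{q+\sqrt q}\ \ \text{for all distinct } i,j\in V_q \text{ with } \{i,j\}\notin E_q.$$ Then $(x^*,X^* )$ is an optimal solution of the semidefinite program $$\max\left\{\mathbf{1}_q^T x : \begin{pmatrix} X & x\\ x^T & 1\end{pmatrix}\succeq 0,\ \mathrm{diag}(X)=x,\ X_{ij}=0\ \ \forall \{i,j\}\in E_q\right\}.$$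
   Context: Paley graph: for a prime power $q$ with $q \equiv 1 \pmod 4$, $P_q$ is the simple undirected graph whose vertex set $V_q$ is the finite field $\mathbb{F}_q$ (elements labelled $0,\dots,q-1$), two vertices being adjacent iff their difference is a nonzero square in $\mathbb{F}_q$; $E_q$ is its edge set. In the semidefinite program, $x\in\mathbb{R}^q$ and $X\in\mathbb{R}^{q\times q}$ (symmetric) are indexed by $V_q$, $\mathbf{1}_q$ is the all-ones vector and $\mathrm{diag}(X)$ is the vector of diagonal entries of $X$. The optimal value of this program is the Lovász theta function $\vartheta(P_q)$. *)

(* Defs.v *)
From HB Require Import structures.
From mathcomp Require Export all_boot all_order all_algebra.
From mathcomp Require Export reals.

Set Implicit Arguments.
Unset Strict Implicit.
Unset Printing Implicit Defensive.

Import Order.TTheory GRing.Theory Num.Theory.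
Local Open Scope ring_scope.

Definition paley_adj (F : finFieldType) (a b : F) : bool :=
  (a - b != 0) && [exists c : F, a - b == c ^+ 2].

(* The vertices are the labels 0, ..., q - 1, and [v] gives the field element
   carrying each label. An edge is an unordered pair of labels, which always
   has two elements because [paley_adj] is irreflexive. *)
Definition paley_edges (q : nat) (F : finFieldType) (v : 'I_q -> F) :
    {set {set 'I_q}} :=
  [set [set e.1; e.2] | e : 'I_q * 'I_q & paley_adj (v e.1) (v e.2)].

Definition psd (R : realType) (n : nat) (M : 'M[R]_n) : Prop :=
  M^T = M /\ forall u : 'cV[R]_n, 0 <= (u^T *m M *m u) 0 0.

(* Symmetry of [X] is part of [psd] of the bordered matrix. *)
Definition theta_feasible (R : realType) (n : nat) (E : {set {set 'I_n}})
    (x : 'cV[R]_n) (X : 'M[R]_n) : Prop :=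
  [/\ psd (block_mx X x x^T (1%:M : 'M[R]_1)),
      forall i, X i i = x i 0
    & forall i j, [set i; j] \in E -> X i j = 0].

Definition theta_objective (R : realType) (n : nat) (x : 'cV[R]_n) : R :=
  ((const_mx 1 : 'cV[R]_n)^T *m x) 0 0.

Definition theta_optimal (R : realType) (n : nat) (E : {set {set 'I_n}})
    (x : 'cV[R]_n) (X : 'M[R]_n) : Prop :=
  theta_feasible E x X /\
  forall (y : 'cV[R]_n) (Y : 'M[R]_n),
    theta_feasible E y Y -> theta_objective y <= theta_objective x.

Definition paley_x (R : realType) (q : nat) : 'cV[R]_q :=
  \col_(i < q) (Num.sqrt q%:R)^-1.

Definition paley_X (R : realType) (q : nat) (E : {set {set 'I_q}}) : 'M[R]_q :=
  \matrix_(i < q, j < q)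
    if i == j then paley_x R q i 0
    else if [set i; j] \in E then 0
    else 2 / (q%:R + Num.sqrt q%:R).

(* Main.v *)
(** Let [S] be the matrix of the quadratic character of [v i - v j]. As -1 is a
    square, [S] is symmetric, and the character sums give [S^2 = q I - J] and
    [S J = 0]. Hence, with [s = sqrt q], both [N = s I + S - J / s] and
    [N' = s I - S - J / s] satisfy [N^2 = 2 s N], so they are psd. The Schur
    complement [X - x x^T] of the proposed solution is [N' / (q + s)], whence
    feasibility. For an arbitrary feasible [(y, Y)] with [t = tr Y = 1^T y], the
    constraint on the edges gives [tr (Y S) = t - tr (Y J)], so
    [0 <= tr (Y N)] means [tr (Y J) <= s t], and testing the bordered matrix on
    the vector [(1, - s)] gives [2 s t <= tr (Y J) + s^2]; together [t <= s]. *)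

Require Import Defs.
From mathcomp Require Import all_boot all_order all_algebra.
From mathcomp Require Import reals.
From mathcomp Require Import cyclic finfield ring lra.

Set Implicit Arguments.
Unset Strict Implicit.
Unset Printing Implicit Defensive.

Import Order.TTheory GRing.Theory Num.Theory.
Local Open Scope ring_scope.

(** * Primitive roots of finite fields *)

Lemma finField_expf_pred_card (F : finFieldType) (x : F) :
  x != 0 -> x ^+ #|F|.-1 = 1.
Proof.
move=> x0; apply: (mulfI x0).
by rewrite -exprS prednK ?mulr1 ?expf_card // (ltnW (finNzRing_gt1 F)).
Qed.

(** The [#|F|.-1] nonzero elements are distinct roots of unity for that exponent, which forces a
    primitive one among them. *)
Lemma finField_has_prim_root (F : finFieldType) :
  exists z : F, #|F|.-1.-primitive_root z.
Proof.
have F_gt1 : (0 < #|F|.-1)%N by rewrite -subn1 subn_gt0 finNzRing_gt1.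
have /hasP[z _ zP] : has (#|F|.-1).-primitive_root (enum (predC1 (0 : F))).
  apply: has_prim_root => //; last by rewrite -cardE cardC1.
    apply/allP => x; rewrite mem_enum /= => x0; apply/unity_rootP.
    exact: finField_expf_pred_card.
  exact: enum_uniq.
by exists z.
Qed.

Lemma primitive_root_neq0 (F : fieldType) (n : nat) (z : F) :
  n.-primitive_root z -> z != 0.
Proof.
move=> zP; apply/eqP => z0; have := prim_expr_order zP.
rewrite z0 expr0n gtn_eqF ?(prim_order_gt0 zP) // => /esym/eqP.
by rewrite oner_eq0.
Qed.

(** * The quadratic character and its sums *)

Definition quad_char (R : pzRingType) (F : finFieldType) (x : F) : R :=
  if x == 0 then 0 else if [exists c : F, x == c ^+ 2] then 1 else -1.

Section QuadraticCharacter.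
Variables (R : realDomainType) (F : finFieldType).
Hypothesis F4 : (4 %| #|F|.-1)%N.

Notation chi := (@quad_char R F).

Lemma quad_char0 : chi 0 = 0. Proof. by rewrite /quad_char eqxx. Qed.

(** As [#|F|.-1] is even, reducing an exponent modulo it keeps the parity, so [z ^+ i] is a square
    exactly when [i] is even. *)
Lemma quad_char_prim_root (z : F) (i : nat) :
  #|F|.-1.-primitive_root z -> chi (z ^+ i) = (-1) ^+ i.
Proof.
move=> zP; have n_even : odd #|F|.-1 = false.
  by apply: negbTE; rewrite -dvdn2; apply: dvdn_trans F4.
have n_gt0 := prim_order_gt0 zP.
rewrite /quad_char expf_eq0 (negbTE (primitive_root_neq0 zP)) andbF.
rewrite -signr_odd; case: existsP => [[c /eqP zc]|nsq].
  have c0 : c != 0.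
    by have := expf_neq0 i (primitive_root_neq0 zP); rewrite zc expf_eq0.
  have [j cj] := prim_rootP zP (finField_expf_pred_card c0).
  move/eqP: zc; rewrite cj -exprM (eq_prim_root_expr zP) => /eqP ij.
  by rewrite -(odd_mod i n_even) ij odd_mod // oddM andbF.
have [//|i_even] := boolP (odd i); case: nsq; exists (z ^+ i./2).
by rewrite -exprM muln2 halfK (negbTE i_even) subn0.
Qed.

Lemma quad_charM (x y : F) : chi (x * y) = chi x * chi y.
Proof.
have [->|x0] := eqVneq x 0; first by rewrite mul0r quad_char0 mul0r.
have [->|y0] := eqVneq y 0; first by rewrite mulr0 quad_char0 mulr0.
have [z zP] := finField_has_prim_root F.
have [i ->] := prim_rootP zP (finField_expf_pred_card x0).
have [j ->] := prim_rootP zP (finField_expf_pred_card y0).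
by rewrite -exprD !quad_char_prim_root // exprD.
Qed.

(** If [-1 = z ^+ i], then [#|F|.-1], hence 4, divides [i * 2], so [i] is even. *)
Lemma quad_charN1 : chi (-1) = 1.
Proof.
have [z zP] := finField_has_prim_root F.
have N1 : (-1 : F) != 0 by rewrite oppr_eq0 oner_eq0.
have [i N1E] := prim_rootP zP (finField_expf_pred_card N1).
have : z ^+ (i * 2) == z ^+ 0 by rewrite exprM -N1E sqrrN expr1n.
rewrite (eq_prim_root_expr zP) mod0n => /(dvdn_trans F4).
rewrite (@dvdn_pmul2r 2 2) // dvdn2 => i_even.
by rewrite N1E quad_char_prim_root // -signr_odd (negbTE i_even).
Qed.

Lemma quad_charN (x : F) : chi (- x) = chi x.
Proof. by rewrite -mulN1r quad_charM quad_charN1 mul1r. Qed.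

Lemma quad_char_sqr (x : F) : chi x * chi x = (x != 0)%:R.
Proof.
rewrite /quad_char; case: eqP => _ /=; first by rewrite mul0r.
by case: ifP => _; rewrite ?mulrNN mulr1.
Qed.

(** Multiplication by a primitive root permutes [F] and negates every value of [chi]. *)
Lemma sum_quad_char : \sum_(x : F) chi x = 0.
Proof.
have [z zP] := finField_has_prim_root F.
have z0 := primitive_root_neq0 zP.
have : \sum_(x : F) chi x = - \sum_(x : F) chi x.
  rewrite [LHS](reindex_inj (mulfI z0)) -mulN1r mulr_sumr.
  apply: eq_bigr => x _; rewrite quad_charM -[z in chi z]expr1.
  by rewrite quad_char_prim_root.
lra.
Qed.

(** These sums are the entries of the square of the character matrix. *)
Lemma sum_quad_char_mul (a b : F) :
  \sum_(c : F) chi (a - c) * chi (c - b) = (a == b)%:R * #|F|%:R - 1.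
Proof.
rewrite (reindex_inj (addIr b)) /=.
under eq_bigr => y _ do rewrite addrK opprD addrCA.
rewrite (bigD1 0) //= quad_char0 mulr0 add0r.
have [->|ab] := eqVneq a b.
  under eq_bigr => y y0 do rewrite subrr addr0 quad_charN quad_char_sqr y0.
  rewrite sumr_const cardC1 mul1r -subn1 natrB //.
  exact: ltnW (finNzRing_gt1 F).
rewrite mul0r sub0r.
set d := a - b; have d0 : d != 0 by rewrite subr_eq0.
(* chi (d - y) * chi y = chi (d / y - 1), and y |-> d / y permutes F^*. *)
transitivity (\sum_(y | y != 0) chi (y - 1)).
  rewrite [RHS](reindex_onto (fun y => d / y) (fun y => d / y)) /=; last first.
    by move=> y y0; rewrite invf_div mulrCA divff ?mulr1.
  apply: eq_big => y.
    rewrite mulf_eq0 invr_eq0 (negbTE d0) /=.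
    have [//|y0] := eqVneq y 0.
    by rewrite invf_div mulrCA divff ?mulr1 ?eqxx.
  move=> y0; have -> : - y + d = (d / y - 1) * y by field.
  by rewrite quad_charM -mulrA quad_char_sqr y0 mulr1.
(* The full sum vanishes by translation; removing its term [chi (-1) = 1] at 0 leaves -1. *)
have : \sum_(y : F) chi (y - 1) = 0.
  by rewrite -[RHS]sum_quad_char [RHS](reindex_inj (addIr (-1))).
rewrite (bigD1 0) //= sub0r quad_charN1; lra.
Qed.

End QuadraticCharacter.

(** * Closure properties of psd matrices *)

Section PositiveSemidefinite.
Variable R : realType.

Lemma psd_gram (m n : nat) (B : 'M[R]_(m, n)) : psd (B^T *m B).
Proof.
split=> [|u]; first by rewrite trmx_mul trmxK.
rewrite mulmxA -trmx_mul -mulmxA mxE sumr_ge0 // => i _.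
by rewrite mxE -expr2 sqr_ge0.
Qed.

Lemma psdD (n : nat) (A B : 'M[R]_n) : psd A -> psd B -> psd (A + B).
Proof.
move=> [At A0] [Bt B0]; split=> [|u]; first by rewrite linearD /= At Bt.
by rewrite mulmxDr mulmxDl mxE addr_ge0.
Qed.

Lemma psdZ (n : nat) (c : R) (A : 'M[R]_n) : 0 <= c -> psd A -> psd (c *: A).
Proof.
move=> c0 [At A0]; split=> [|u]; first by rewrite linearZ /= At.
by rewrite -scalemxAr -scalemxAl mxE mulr_ge0.
Qed.

Lemma psd_congr (m n : nat) (M : 'M[R]_m) (B : 'M[R]_(m, n)) :
  psd M -> psd (B^T *m M *m B).
Proof.
move=> [Mt M0]; split=> [|u]; first by rewrite !trmx_mul trmxK Mt mulmxA.
by have := M0 (B *m u); rewrite trmx_mul !mulmxA.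
Qed.

Lemma psd_tr_ge0 (n : nat) (M : 'M[R]_n) : psd M -> 0 <= \tr M.
Proof.
move=> [_ M0]; apply: sumr_ge0 => i _; have := M0 (delta_mx i 0).
by rewrite trmx_delta -rowE -colE !mxE.
Qed.

(** The sufficient half of the Schur complement criterion: the bordered matrix is [A] padded with
    zeros plus the Gram matrix of the row [(x^T, 1)]. *)
Lemma psd_border (n : nat) (A : 'M[R]_n) (x : 'cV[R]_n) :
  psd A -> psd (block_mx (A + x *m x^T) x x^T (1%:M : 'M_1)).
Proof.
move=> psdA.
have -> : block_mx (A + x *m x^T) x x^T (1%:M : 'M_1) =
    (row_mx 1%:M (0 : 'cV_n))^T *m A *m row_mx 1%:M (0 : 'cV_n)
    + (row_mx x^T (1%:M : 'M_1))^T *m row_mx x^T 1%:M.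
  rewrite !tr_row_mx !trmx1 trmx0 trmxK mul_col_mx !mul_col_row add_block_mx.
  by rewrite !(mul1mx, mulmx1, mul0mx, mulmx0) !add0r.
by apply: psdD; [apply: psd_congr | apply: psd_gram].
Qed.

End PositiveSemidefinite.

(** * Optimality from the identities S^2 = n I - J and S J = 0 *)

Section ConferenceMatrix.
Variables (R : realType) (n : nat) (S : 'M[R]_n).
Hypotheses (n_gt0 : (0 < n)%N) (S_sym : S^T = S).

Notation J := (const_mx 1 : 'M[R]_n).
Notation s := (Num.sqrt n%:R : R).

Hypotheses (SS : S *m S = n%:R%:M - J) (SJ : S *m J = 0).

Lemma sqrt_size_gt0 : 0 < s. Proof. by rewrite sqrtr_gt0 ltr0n. Qed.

Lemma sqr_sqrt_size : s * s = n%:R.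
Proof. by rewrite -expr2 sqr_sqrtr // ler0n. Qed.

Lemma mulJS : J *m S = 0.
Proof. by rewrite -[J *m S]trmxK trmx_mul S_sym trmx_const SJ trmx0. Qed.

Lemma mulJJ : J *m J = n%:R *: J.
Proof.
apply/matrixP => i j; rewrite !mxE; under eq_bigr do rewrite !mxE mulr1.
by rewrite sumr_const card_ord mulr1.
Qed.

(** [N] kills the all-ones vector, since s = n / s; on its orthogonal complement S^2 = n I, so [N]
    has eigenvalues 0 and 2 s only. The sign [e] is -1 for feasibility and 1 for the upper bound. *)
Lemma scaled_projection (e : R) : e * e = 1 ->
  let N := s%:M + e *: S - s^-1 *: J in
  N^T = N /\ N *m N = (2 * s) *: N.
Proof.
move=> ee N; split.
  rewrite /N linearB linearD /= !linearZ /= tr_scalar_mx S_sym.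
  by rewrite trmx_const.
rewrite {1}/N mulmxBl mulmxDl mul_scalar_mx -!scalemxAl /N.
rewrite !mulmxBr !mulmxDr !mul_mx_scalar -!scalemxAr SS SJ mulJS mulJJ.
rewrite [e *: (_ - _)]scalerBr [e *: (_ + _)]scalerDr [e *: (e *: _)]scalerA ee.
move: sqrt_size_gt0 sqr_sqrt_size; move: s => t t_gt0 <-.
have t0 : t != 0 by rewrite gt_eqF.
apply/matrixP => i j; rewrite !mxE.
by case: (i == j); rewrite ?mulr1n ?mulr0n; field.
Qed.

Lemma paley_x_outer : paley_x R n *m (paley_x R n)^T = n%:R^-1 *: J.
Proof.
apply/matrixP => i j.
by rewrite !mxE big_ord1 !mxE -invfM sqr_sqrt_size mulr1.
Qed.

Variable E : {set {set 'I_n}}.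
Hypotheses (S_diag : forall i, S i i = 0).
Hypothesis E_irr : forall i, [set i; i] \notin E.
Hypothesis S_off :
  forall i j, i != j -> S i j = if [set i; j] \in E then 1 else -1.

(** On the diagonal, n + s = s (s + 1) turns (s + 1) / (n + s) into 1 / s; elsewhere 1 - S is 0 on
    edges and 2 on non-edges. *)
Lemma paley_X_conferenceE : paley_X R E = (n%:R + s)^-1 *: (s%:M + J - S).
Proof.
apply/matrixP => i j; rewrite !mxE.
move: sqrt_size_gt0 sqr_sqrt_size; move: s => t t_gt0 <-.
have [<-|ij] := eqVneq i j.
  by rewrite S_diag mulr1n; field; rewrite !gt_eqF //; nra.
rewrite S_off //; case: ifP => _; rewrite mulr0n.
  by ring.
by field; rewrite gt_eqF //; nra.
Qed.

Lemma conference_feasible : theta_feasible E (paley_x R n) (paley_X R E).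
Proof.
split=> [|i|i j ijE].
- have [|Nt NN] := @scaled_projection (-1); first by rewrite mulrNN mulr1.
  set N := s%:M + _ - _ in Nt NN.
  (* By N^2 = 2 s N the first summand is N / (n + s), the Schur complement. *)
  have -> : paley_X R E =
      ((n%:R + s) * (2 * s))^-1 *: (N^T *m N) + paley_x R n *m (paley_x R n)^T.
    rewrite Nt NN paley_X_conferenceE paley_x_outer /N.
    move: sqrt_size_gt0 sqr_sqrt_size; move: (s) => t t_gt0 <-.
    apply/matrixP => i j; rewrite !mxE; case: (i == j); rewrite ?mulr1n ?mulr0n.
      by field; rewrite !gt_eqF //; nra.
    by field; rewrite !gt_eqF //; nra.
  apply/psd_border/psdZ/psd_gram.
  by rewrite invr_ge0 !mulr_ge0 ?addr_ge0 ?ler0n ?sqrtr_ge0.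
- by rewrite !mxE eqxx.
- rewrite mxE ijE; case: eqP => // ij.
  by move: (E_irr i); rewrite {2}ij ijE.
Qed.

(** [S] agrees with I - J away from the edges, and [Y] vanishes on the edges. *)
Lemma mxtrace_feasible_mul (y : 'cV[R]_n) (Y : 'M[R]_n) :
  theta_feasible E y Y -> \tr (Y *m S) = \tr Y - \tr (Y *m J).
Proof.
move=> [_ _ YE]; rewrite -[X in \tr X - _](mulmx1 Y) -linearB -mulmxBr /=.
apply: eq_bigr => i _; rewrite !mxE; apply: eq_bigr => j _; rewrite !mxE.
have [->|ij] := eqVneq j i; first by rewrite S_diag subrr.
rewrite S_off // mulr0n sub0r; case: ifP => // ijE.
by rewrite YE ?mul0r // setUC.
Qed.

Lemma conference_bound (y : 'cV[R]_n) (Y : 'M[R]_n) :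
  theta_feasible E y Y -> theta_objective y <= s.
Proof.
move=> Yfeas; have trYS := mxtrace_feasible_mul Yfeas.
case: Yfeas => psdY diagY _.
have trY : \tr Y = theta_objective y.
  rewrite /theta_objective mxE; apply: eq_bigr => i _.
  by rewrite diagY !mxE mul1r.
pose e : 'cV[R]_n := const_mx 1.
have eeT : e *m e^T = J.
  by apply/matrixP => i j; rewrite !mxE big_ord1 !mxE mulr1.
have s_gt0 := sqrt_size_gt0.
have psdYul : psd Y.
  have := psd_congr (col_mx 1%:M (0 : 'M_(1, n))) psdY.
  rewrite tr_col_mx trmx1 trmx0 mul_row_block mul_row_col.
  by rewrite !(mul1mx, mulmx1, mul0mx, mulmx0) !addr0.
have trYN : 0 <= s * \tr Y + \tr (Y *m S) - s^-1 * \tr (Y *m J).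
  have [|Nt NN] := @scaled_projection 1; first exact: mulr1.
  set N := s%:M + _ - _ in Nt NN.
  (* By cyclicity of the trace, tr (N^T Y N) = tr (Y N^2) = 2 s tr (Y N). *)
  have := psd_tr_ge0 (psd_congr N psdYul).
  rewrite mxtrace_mulC Nt mulmxA NN -scalemxAl mxtraceZ pmulr_rge0 ?mulr_gt0 //.
  rewrite mxtrace_mulC /N scale1r mulmxBr mulmxDr mul_mx_scalar -scalemxAr.
  by rewrite linearB linearD /= !mxtraceZ.
have trYJ : 0 <= \tr (Y *m J) - 2 * s * \tr Y + s * s.
  (* The weight -s makes the quadratic form vanish at the proposed optimum, so this inequality is
     tight there. *)
  have := (psdY.2 (col_mx e (- s)%:M)).
  rewrite tr_col_mx mul_row_block mul_row_col tr_scalar_mx mulmx1.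
  rewrite mulmxDl !mul_mx_scalar !mul_scalar_mx -scalemxAl.
  have yTe : y^T *m e = (e^T *m y)^T by rewrite trmx_mul trmxK.
  rewrite -eeT mulmxA mxtrace_mulC mulmxA trace_mx11 trY yTe.
  rewrite /theta_objective -/e; set a := e^T *m Y *m e; set b := e^T *m y.
  rewrite !mxE eqxx mulr1n; lra.
rewrite trYS in trYN; rewrite -trY.
move: (\tr Y) (\tr (Y *m J)) trYN trYJ s_gt0 => t u.
move: s => r H1 H2 r0.
(* Multiplying the inequality for [N] by [r] clears the inverse and lets the positive factor [r + 1]
   split off, leaving u <= r t. *)
have : 0 <= (r + 1) * (r * t - u).
  have -> : (r + 1) * (r * t - u) = r * (r * t + (t - u) - r^-1 * u).
    by field; rewrite gt_eqF.
  by rewrite mulr_ge0 // ltW.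
rewrite pmulr_rge0; last by lra.
move=> H3; rewrite -(ler_pM2l r0); lra.
Qed.

Theorem conference_optimal : theta_optimal E (paley_x R n) (paley_X R E).
Proof.
split=> [|y Y Yfeas]; first exact: conference_feasible.
have -> : theta_objective (paley_x R n) = s; last exact: conference_bound Yfeas.
rewrite /theta_objective mxE.
under eq_bigr do rewrite !mxE mul1r.
rewrite sumr_const card_ord -[LHS]mulr_natl.
move: sqrt_size_gt0 sqr_sqrt_size; move: s => t t_gt0 <-.
by rewrite mulfK // gt_eqF.
Qed.

End ConferenceMatrix.

(** * The Paley graph and its character matrix *)

Lemma paley_adjE (F : finFieldType) (a b : F) :
  paley_adj a b = (quad_char int (a - b) == 1).
Proof. by rewrite /paley_adj /quad_char; case: (a - b == 0); case: existsP. Qed.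

Section PaleyGraph.
Variables (R : realType) (q : nat) (F : finFieldType) (v : 'I_q -> F).
Hypotheses (v_bij : bijective v) (F4 : (4 %| #|F|.-1)%N).

(** An unordered edge may come from either ordering of its ends; adjacency is symmetric because -1
    is a square, and irreflexive, so the two ends are exactly [i] and [j]. *)
Lemma mem_paley_edges (i j : 'I_q) :
  ([set i; j] \in paley_edges v) = paley_adj (v i) (v j).
Proof.
have symF (a b : F) : paley_adj a b = paley_adj b a.
  by rewrite !paley_adjE -opprB quad_charN.
apply/imsetP/idP => [[[a b] /=]|ij]; last by exists (i, j); rewrite ?inE.
rewrite inE /= => ab ijE.
have aI : a \in [set i; j] by rewrite ijE set21.
have bI : b \in [set i; j] by rewrite ijE set22.
have nab : a != b.
  by apply: contraTneq ab => ->; rewrite /paley_adj subrr eqxx.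
move: aI bI nab ab; rewrite !in_set2.
by move=> /orP[]/eqP-> /orP[]/eqP->; rewrite ?eqxx // symF.
Qed.

(** This is minus the usual Seidel matrix: 1 on edges, -1 on non-edges. *)
Definition paley_seidel : 'M[R]_q := \matrix_(i, j) quad_char R (v i - v j).

Lemma paley_seidel_sym : paley_seidel^T = paley_seidel.
Proof. by apply/matrixP => i j; rewrite !mxE -opprB quad_charN. Qed.

Lemma card_paley_field : #|F| = q.
Proof. by rewrite -(bij_eq_card v_bij) card_ord. Qed.

Lemma sum_paley_vertices (f : F -> R) : \sum_(k < q) f (v k) = \sum_(x : F) f x.
Proof. by rewrite [RHS](reindex v) //; apply: onW_bij. Qed.

Lemma paley_seidel_sqr :
  paley_seidel *m paley_seidel = q%:R%:M - const_mx 1.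
Proof.
apply/matrixP => i j; rewrite !mxE.
under eq_bigr do rewrite !mxE.
rewrite (sum_paley_vertices
  (fun x => quad_char R (v i - x) * quad_char R (x - v j))).
rewrite sum_quad_char_mul // (inj_eq (bij_inj v_bij)) card_paley_field.
by rewrite mulr_natl.
Qed.

Lemma paley_seidel_const : paley_seidel *m (const_mx 1 : 'M_q) = 0.
Proof.
apply/matrixP => i j; rewrite !mxE.
under eq_bigr do rewrite !mxE mulr1.
rewrite (sum_paley_vertices (fun x => quad_char R (v i - x))).
rewrite -[RHS](@sum_quad_char R F F4).
(* A negation followed by a translation is the substitution of [v i - x] for [x]. *)
rewrite [RHS](reindex_inj (inv_inj (@opprK F))) /=.
rewrite [RHS](reindex_inj (addrI (- v i))) /=.
by apply: eq_bigr => x _; rewrite opprD opprK.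
Qed.

End PaleyGraph.

Theorem lemma10 (R : realType) (p k q : nat)
  (hp : prime p) (hk : (0 < k)%N) (hq : q = (p ^ k)%N) (hq4 : q = 1 %[mod 4])
  (F : finFieldType) (v : 'I_q -> F) (hv : bijective v) :
  theta_optimal (paley_edges v) (paley_x R q) (paley_X R (paley_edges v)).
Proof.
have q_gt0 : (0 < q)%N by rewrite hq expn_gt0 prime_gt0.
have F4 : (4 %| #|F|.-1)%N.
  by rewrite (card_paley_field hv) -subn1 -eqn_mod_dvd // hq4.
have irr i : [set i; i] \notin paley_edges v.
  by rewrite mem_paley_edges // /paley_adj subrr eqxx.
apply: (conference_optimal q_gt0 (paley_seidel_sym R v F4)
          (paley_seidel_sqr R hv F4) (paley_seidel_const R hv F4)) =>
  // [i|i j ij].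
  by rewrite mxE subrr quad_char0.
(* Injectivity of [v] rules out the zero value of the character off the diagonal. *)
rewrite mem_paley_edges // mxE /quad_char /paley_adj subr_eq0.
by rewrite (inj_eq (bij_inj hv)) (negbTE ij).
Qed.
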